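(* Let $X_1,\dots,X_n$ be independent and identically distributed real random variables with distribution function $F$, let $X_{1:n}\le\cdots\le X_{n:n}$ be their order statistics, let $1\le r\le n$, and let $t$ be such that $F(t)>0$. Then for every real $x$, $P\{X_1\le x\mid X_{r:n}\le t\}$ equals $$\begin{cases} \dfrac{F(x)\sum_{i=r-1}^{n-1}\binom{n-1}{i}F(t)^i(1-F(t))^{n-1-i}}{\sum_{i=r}^{n}\binom{n}{i}F(t)^i(1-F(t))^{n-i}}, & x\le t,\\[4mm] \dfrac{F(x)\sum_{i=r-1}^{n-1}\binom{n-1}{i}F(t)^i(1-F(t))^{n-1-i}-\binom{n-1}{r-1}(F(x)-F(t))F(t)^{r-1}(1-F(t))^{n-r}}{\sum_{i=r}^{n}\binom{n}{i}F(t)^i(1-F(t))^{n-i}}, & x>t.\end{cases}$$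
   Context: $F(x)=P\{X_1\le x\}$; $X_{r:n}$ is the $r$th smallest value among $X_1,\dots,X_n$. The convention $0^0=1$ is used. *)

(* Defs.v *)
From HB Require Import structures.
From mathcomp Require Import all_boot all_order all_algebra.
From mathcomp Require Import all_classical all_reals all_analysis.

Set Implicit Arguments.
Unset Strict Implicit.
Unset Printing Implicit Defensive.

Import Order.TTheory GRing.Theory Num.Theory.

Local Open Scope classical_set_scope.
Local Open Scope ring_scope.

Section defs.
Context (d : measure_display) (T : measurableType d) (R : realType)
  (P : probability T R).

(* The subfamily is given by J; with B ranging over all families of Borel sets
   this is mutual independence of the generated sigma-algebras. *)
Definition mutually_independent (n : nat) (X : 'I_n -> {RV P >-> R}) : Prop :=
  forall (J : {set 'I_n}) (B : 'I_n -> set R),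
    (forall i, measurable (B i)) ->
    P [set w | forall i, i \in J -> B i (X i w)]
    = (\prod_(i in J) P (X i @^-1` B i))%E.

Definition identically_distributed (n : nat) (X : 'I_n -> {RV P >-> R}) : Prop :=
  forall (i j : 'I_n) (A : set R), measurable A ->
    distribution P (X i) A = distribution P (X j) A.

Definition iid (n : nat) (X : 'I_n -> {RV P >-> R}) : Prop :=
  mutually_independent X /\ identically_distributed X.

(* The ranks r are 1-based, 1 <= r <= n; outside that range the value carries
   no meaning. *)
Definition order_stat (n : nat) (X : 'I_n -> {RV P >-> R}) (r : nat) (w : T) : R :=
  nth 0 (sort <=%R [seq X i w | i <- enum 'I_n]) (r - 1)%N.

(* Meaningful when P B != 0; division by zero makes it 0 otherwise. *)
Definition cond_prob (A B : set T) : R := fine (P (A `&` B)) / fine (P B).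

(* Real-valued version of the extended-real-valued [cdf]. *)
Definition dist_fun (X : {RV P >-> R}) (x : R) : R := fine (cdf X x).

End defs.

(* Main.v *)
Require Import Defs.
From HB Require Import structures.
From mathcomp Require Import all_boot all_order all_algebra.
From mathcomp Require Import all_classical all_reals all_analysis.
From mathcomp Require Import zify ring.

(** Write [p = F t] and call index [i] a hit when [X i <= t].  Sorting shows
    that [X_{r:n} <= t] holds exactly when there are at least [r] hits
    ([order_stat_leE]), so the conditioning event only concerns the number of
    hits.

    The general fact is [prob_hits_ge]: fix a set [K] of indices, ask for at
    least [k] hits inside [K], and constrain every variable outside [K] by its
    own Borel set.  Splitting the event according to which subset [J] of [K]
    is hit gives finitely many disjoint pieces, each of which prescribes one
    Borel set for every variable; mutual independence makes the probability of
    a piece a product, with factor [p ^+ #|J| * (1 - p) ^+ (#|K| - #|J|)]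
    coming from [K].  Collecting the subsets of equal cardinality produces the
    binomial tail, multiplied by the probabilities of the outside constraints.

    With [K] the full index set this is the denominator.  For the numerator,
    take [K] to be all indices but the first: when [X_1] is itself a hit the
    others must supply [r - 1] hits, otherwise [r] ([prob_joint]).  If
    [x <= t], the event [X_1 <= x] forces a hit and only the first case
    remains.  If [x > t], the two cases have weights [F t] and [F x - F t], and
    the tail from [r] is the tail from [r - 1] minus its first term, which is
    the correction term of the formula. *)

Set Implicit Arguments.
Unset Strict Implicit.
Unset Printing Implicit Defensive.

Import Order.TTheory GRing.Theory Num.Theory.

Local Open Scope classical_set_scope.
Local Open Scope ring_scope.

(** * Combinatorics and finite partitions *)

(** In a sorted sequence the entries [<= x] form a prefix, so position [i] lies
    in that prefix exactly when the prefix is longer than [i]. *)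
Lemma nth_sort_le (d : Order.disp_t) (T : orderType d) (x0 x : T)
    (s : seq T) i :
  (i < size s)%N ->
  (nth x0 (sort <=%O s) i <= x)%O = (i < count (fun y => y <= x)%O s)%N.
Proof.
move=> ilt; have ss : sorted <=%O (sort <=%O s) by exact: sort_le_sorted.
have /permP <- : perm_eq (sort <=%O s) s by rewrite perm_sort.
apply/idP/idP; last exact: nth_count_le.
apply: contraTT; rewrite -leqNgt -ltNge => ci.
by apply: nth_count_gt => //; rewrite ci size_sort.
Qed.

Definition binomial_tail (R : pzRingType) (m k : nat) (p : R) : R :=
  \sum_(k <= j < m.+1) 'C(m, j)%:R * p ^+ j * (1 - p) ^+ (m - j).

(** A summand depends on [J] only through its cardinality, and there are
    ['C(#|K|, j)] subsets of [K] of cardinality [j]. *)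
Lemma sum_subsets_binomial_tail (R : pzRingType) (I : finType) (K : {set I})
    (k : nat) (p : R) :
  \sum_(J : {set I} | (J \subset K) && (k <= #|J|)%N)
     p ^+ #|J| * (1 - p) ^+ (#|K| - #|J|) = binomial_tail #|K| k p.
Proof.
rewrite /binomial_tail big_geq_mkord.
(* [inord] is harmless here: a subset of [K] has at most [#|K|] elements. *)
rewrite (partition_big (fun J : {set I} => inord #|J| : 'I_#|K|.+1)
  (fun j => k <= j)%N) /=; last first.
  by move=> J /andP[JK kJ]; rewrite inordK // ltnS subset_leq_card.
apply: eq_bigr => j kj; rewrite -mulrA -cards_draws mulr_natl -sumr_const.
apply: eq_big => [J|J].
  rewrite inE; case: (boolP (J \subset K)) => //= JK.
  rewrite -val_eqE /= inordK ?ltnS ?subset_leq_card//.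
  by case: eqP => [->|]; rewrite ?kj ?andbF.
case/andP => /andP[JK _] /eqP <-.
by rewrite inordK ?ltnS ?subset_leq_card.
Qed.

Lemma measure_fin_partition d (T : measurableType d) (R : realType)
    (mu : {measure set T -> \bar R}) (I : finType) (g : T -> I) (E : set T) :
  (forall i, measurable (E `&` g @^-1` [set i])) ->
  mu E = (\sum_i mu (E `&` g @^-1` [set i]))%E.
Proof.
move=> mE; rewrite (bigfs _ (index_enum_uniq I)); last first.
  by move=> i _; rewrite mem_index_enum.
have -> : [set` xpredT] = [set: I] by apply/seteqP.
rewrite -measure_fin_bigcup//.
- by congr (mu _); apply/seteqP; split=> [w Ew|w [i _ []]//]; exists (g w).
- exact: finite_finset.
- apply/trivIsetP => i j _ _ /eqP ij.
  by apply/seteqP; split=> // w [[_ gi] [_ gj]]; apply: ij; rewrite -gi -gj.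
Qed.

(** * Numbers of hits among independent variables *)

Section hits.
Context d (T : measurableType d) (R : realType) (P : probability T R) (n : nat).
Context (X : 'I_n -> {RV P >-> R}).

Definition hits (A : set R) (w : T) : {set 'I_n} :=
  [set i | X i w \in A]%SET.

Lemma order_stat_leE r t w : (1 <= r <= n)%N ->
  (order_stat X r w <= t) = (r <= #|hits `]-oo, t] w|)%N.
Proof.
case/andP => r0 rn; rewrite /order_stat nth_sort_le; last first.
  by rewrite size_map size_enum_ord; lia.
rewrite subn1 prednK// count_map -sum1_count -sum1_card big_enum_cond /=.
by congr (r <= _)%N; apply: eq_bigl => i; rewrite !inE mem_setE in_itv.
Qed.

(** The Borel set to which [X i] is confined once the hits inside [K] are
    required to be exactly [J] and the variables outside [K] to obey [B]. *)
Definition pattern (A : set R) (B : 'I_n -> set R) (K J : {set 'I_n})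
    (i : 'I_n) : set R :=
  if i \notin K then B i else if i \in J then A else ~` A.

(** Fixing the set of hits inside [K] turns a condition on their number into
    separate conditions on the individual variables, the form to which
    independence applies. *)
Lemma hits_eqE A B (K J : {set 'I_n}) (k : nat) :
  [set w | (forall i, i \notin K -> B i (X i w)) /\
           (k <= #|hits A w :&: K|)%N]
    `&` (fun w => hits A w :&: K) @^-1` [set J] =
  if (J \subset K) && (k <= #|J|)%N then
    [set w | forall i, i \in [set: 'I_n]%SET -> pattern A B K J i (X i w)]
  else set0.
Proof.
case: ifPn => [/andP[JK kJ]|nJ]; apply/seteqP; split=> w //=.
- move=> [[EB _] HJ] i _; rewrite /pattern; case: ifPn => [/EB//|].
  rewrite negbK => iK; rewrite -HJ !inE iK andbT.
  by case: ifPn; rewrite ?inE ?notin_setE.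
- move=> H.
  have HJ : hits A w :&: K = J.
    apply/setP => i; rewrite !inE; have := H i (finset.in_setT i).
    rewrite /pattern; case: (boolP (i \in K)) => /= iK.
      by rewrite andbT; case: ifPn => _ ?; [rewrite mem_set|rewrite memNset].
    move=> _; rewrite andbF; apply/esym; apply: contraNF iK => iJ.
    exact: (fintype.subsetP JK).
  split=> //; split; last by rewrite HJ.
  by move=> i iK; have := H i (finset.in_setT i); rewrite /pattern iK.
- move=> [[_ kJ] HJ]; move: nJ; rewrite -HJ kJ andbT.
  by rewrite subsetIr.
Qed.

Section measurable_family.
Context (A : set R) (B : 'I_n -> set R).
Context (mA : measurable A) (mB : forall i, measurable (B i)).

Lemma measurable_pattern K J i : measurable (pattern A B K J i).
Proof.
by rewrite /pattern; do 2!case: ifP => // _; exact: measurableC.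
Qed.

Lemma measurable_hits_eq (K J : {set 'I_n}) (k : nat) :
  measurable ([set w | (forall i, i \notin K -> B i (X i w)) /\
                       (k <= #|hits A w :&: K|)%N]
                `&` (fun w => hits A w :&: K) @^-1` [set J]).
Proof.
rewrite hits_eqE; case: ifP => // _.
have -> : [set w | forall i, i \in [set: 'I_n]%SET ->
                     pattern A B K J i (X i w)] =
          \bigcap_(i in [set: 'I_n]) (X i @^-1` pattern A B K J i).
  by apply/seteqP; split=> w H i _;
    [exact: (H i (finset.in_setT i))|exact: (H i I)].
apply: fin_bigcap_measurable => // i _.
by apply: measurable_funPTI => //; exact: measurable_pattern.
Qed.

Lemma measurable_hits_ge (K : {set 'I_n}) (k : nat) :
  measurable [set w | (forall i, i \notin K -> B i (X i w)) /\
                      (k <= #|hits A w :&: K|)%N].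
Proof.
set E := (X in measurable X).
have -> : E = \bigcup_(J in [set: {set 'I_n}])
                (E `&` (fun w => hits A w :&: K) @^-1` [set J]).
  by apply/seteqP; split=> [w Ew|w [J _ []]//]; exists (hits A w :&: K).
by apply: fin_bigcup_measurable => // J _; exact: measurable_hits_eq.
Qed.

(** Sum over the possible sets [J] of hits inside [K]: by independence a piece
    has probability the product over all indices, in which the indices outside
    [K] contribute a factor common to all [J], those in [J] the factor [p] and
    those in [K] but not in [J] the factor [1 - p]. *)
Lemma prob_hits_ge (p : R) (K : {set 'I_n}) (k : nat) :
  mutually_independent X -> (forall i, P (X i @^-1` A) = p%:E) ->
  P [set w | (forall i, i \notin K -> B i (X i w)) /\
             (k <= #|hits A w :&: K|)%N]
  = ((\prod_(i | i \notin K) P (X i @^-1` B i))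
     * (binomial_tail #|K| k p)%:E)%E.
Proof.
move=> indX PA.
rewrite (@measure_fin_partition _ _ _ P _ (fun w => hits A w :&: K));
  last by move=> J; exact: measurable_hits_eq.
rewrite -sum_subsets_binomial_tail.
have mX i (C : set R) : measurable C -> measurable (X i @^-1` C).
  by move=> mC; exact: measurable_funPTI.
have PB i : P (X i @^-1` B i) \is a fin_num.
  by apply: fin_num_measure; exact: mX.
have -> : (\prod_(i | i \notin K) P (X i @^-1` B i) =
    (\prod_(i | i \notin K) fine (P (X i @^-1` B i)))%:E)%E.
  by rewrite -prodEFin; apply: eq_bigr => i _; rewrite fineK.
rewrite -EFinM big_distrr/= -sumEFin [RHS]big_mkcond/=.
apply: eq_bigr => J _; rewrite hits_eqE.
case: ifPn => [/andP[JK _]|_]; last by rewrite measure0.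
rewrite indX; last by move=> i; exact: measurable_pattern.
transitivity (\prod_i (if i \notin K then fine (P (X i @^-1` B i))
   else if i \in J then p else 1 - p))%:E.
  rewrite -prodEFin; apply: eq_big => [i|i _]; first by rewrite inE.
  rewrite /pattern; case: ifPn => _; first by rewrite fineK.
  by case: ifPn => _ //; rewrite preimage_setC probability_setC ?PA//;
    exact: mX.
congr EFin; rewrite (bigID (fun i => i \notin K))/=; congr (_ * _).
  by apply: eq_bigr => i ->.
rewrite (eq_bigl (fun i => i \in K)); last by move=> i; rewrite negbK.
under eq_bigr => i iK do rewrite iK /=.
rewrite (bigID (fun i => i \in J))/=; congr (_ * _).
  rewrite (eq_bigl (fun i => i \in J)); last first.
    move=> i; case: (boolP (i \in J)) => iJ; rewrite ?andbF// andbT.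
    exact: (fintype.subsetP JK).
  by under eq_bigr => i iJ do rewrite iJ; rewrite prodr_const.
rewrite (eq_bigl (fun i => i \in K :\: J)); last by move=> i; rewrite inE andbC.
under eq_bigr => i. rewrite inE => /andP[/negbTE -> _]. over.
rewrite prodr_const cardsD; congr (_ ^+ (_ - _)).
by rewrite (finset.setIidPr JK).
Qed.

End measurable_family.

(** Either [i0] is a hit and one hit fewer is needed from the others, or it is
    not and the others must provide them all. *)
Lemma hits_ge_split A B i0 r :
  [set w | B (X i0 w) /\ (r <= #|hits A w|)%N] =
  [set w | (A `&` B) (X i0 w) /\ (r - 1 <= #|hits A w :&: [set~ i0]%SET|)%N]
  `|` [set w | (B `\` A) (X i0 w) /\ (r <= #|hits A w :&: [set~ i0]%SET|)%N].
Proof.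
have hE w : #|hits A w| = ((X i0 w \in A) + #|hits A w :&: [set~ i0]%SET|)%N.
  by rewrite (cardsD1 i0) -finset.setDE !inE.
apply/seteqP; split=> w /=; rewrite hE.
  case: (pselect (A (X i0 w))) => wA [wB].
    by rewrite mem_set// => rh; left; split; rewrite ?leq_subLR.
  by rewrite memNset => // rh; right.
case=> -[[]]; first by move=> wA wB; rewrite leq_subLR mem_set.
by move=> wB wA rh; rewrite memNset.
Qed.

(** Both halves of [hits_ge_split] are instances of [prob_hits_ge] in which
    [i0] is the only index outside [K]. *)
Lemma prob_joint (A : set R) (p : R) B i0 r : mutually_independent X ->
  (forall i, P (X i @^-1` A) = p%:E) ->
  measurable A -> measurable B ->
  P [set w | B (X i0 w) /\ (r <= #|hits A w|)%N] =
  (P (X i0 @^-1` (A `&` B)) * (binomial_tail n.-1 (r - 1) p)%:E +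
   P (X i0 @^-1` (B `\` A)) * (binomial_tail n.-1 r p)%:E)%E.
Proof.
move=> indX PA mA mB; rewrite (hits_ge_split A).
pose others k w := (k <= #|hits A w :&: [set~ i0]%SET|)%N.
have E C k : [set w | C (X i0 w) /\ others k w] =
    [set w | (forall i, i \notin [set~ i0]%SET -> C (X i w)) /\ others k w].
  apply/seteqP; split=> w /= [Cw kw]; split=> //.
    by move=> i; rewrite !inE negbK => /eqP ->.
  by apply: Cw; rewrite !inE negbK.
have mE C k : measurable C -> measurable [set w | C (X i0 w) /\ others k w].
  by move=> mC; rewrite E; exact: (@measurable_hits_ge A (fun=> C)).
have PE C k : measurable C ->
    P [set w | C (X i0 w) /\ others k w] =
    (P (X i0 @^-1` C) * (binomial_tail n.-1 k p)%:E)%E.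
  move=> mC; rewrite E; transitivity
      (\prod_(i | i \notin [set~ i0]%SET) P (X i @^-1` C) *
       (binomial_tail #|[set~ i0]%SET| k p)%:E)%E.
    exact: (@prob_hits_ge A (fun=> C)).
  by rewrite cardsC1 card_ord (big_pred1 i0)// => i; rewrite !inE negbK.
have mAB : measurable (A `&` B) by exact: measurableI.
have mBA : measurable (B `\` A) by exact: measurableD.
rewrite -(PE (A `&` B))// -(PE (B `\` A))//.
apply: measureU; [exact: mE|exact: mE|].
by apply/seteqP; split => // w /= [[[wA _] _] [[_ /(_ wA)]]].
Qed.

End hits.

(** * The conditional distribution *)

Theorem corollary1 (d : measure_display) (T : measurableType d) (R : realType)
  (P : probability T R) (n : nat) (hn : (0 < n)%N)
  (X : 'I_n -> {RV P >-> R}) (hX : iid X)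
  (r : nat) (hr : (1 <= r <= n)%N)
  (t : R) (ht : 0 < dist_fun (X (Ordinal hn)) t) (x : R) :
  let X1 := X (Ordinal hn) in
  let F := dist_fun X1 in
  let S := \sum_(r - 1 <= i < n)
             'C(n - 1, i)%:R * F t ^+ i * (1 - F t) ^+ (n - 1 - i) in
  let D := \sum_(r <= i < n.+1)
             'C(n, i)%:R * F t ^+ i * (1 - F t) ^+ (n - i) in
  cond_prob P [set w | X1 w <= x] [set w | order_stat X r w <= t]
  = if x <= t then F x * S / D
    else (F x * S
          - 'C(n - 1, r - 1)%:R * (F x - F t)
            * F t ^+ (r - 1) * (1 - F t) ^+ (n - r)) / D.
Proof.
move=> X1 F S D; case: hX => indX idX.
have PX y : P (X1 @^-1` `]-oo, y]) = (F y)%:E.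
  by rewrite /F /dist_fun fineK// fin_num_measure//; exact: measurable_funPTI.
have PXt i : P (X i @^-1` `]-oo, t]) = (F t)%:E.
  by rewrite -PX; exact: (idX i (Ordinal hn)).
(* The upper bound [n] of the sum [S] is [n.-1.+1], as [0 < n]. *)
have SE : S = binomial_tail n.-1 (r - 1) (F t).
  by rewrite /S /binomial_tail prednK// -subn1.
have tailr : binomial_tail n.-1 r (F t)
    = S - 'C(n - 1, r - 1)%:R * F t ^+ (r - 1) * (1 - F t) ^+ (n - r).
  have r1 : (r - 1).+1 = r by lia.
  rewrite SE /binomial_tail [in RHS]big_ltn ?r1; last by lia.
  rewrite prednK// -subn1 (_ : n - 1 - (r - 1) = n - r)%N; last by lia.
  by rewrite addrAC subrr add0r.
have DE : P [set w | order_stat X r w <= t] = D%:E.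
  have -> : [set w | order_stat X r w <= t] =
     [set w | (forall i, i \notin [set: 'I_n]%SET -> setT (X i w)) /\
         (r <= #|hits X `]-oo, t] w :&: [set: 'I_n]%SET|)%N].
    apply/seteqP; split=> w /=; rewrite order_stat_leE// finset.setIT;
      by [|case].
  rewrite (@prob_hits_ge _ _ _ _ _ X `]-oo, t] (fun=> setT) _ _ (F t))//.
  by rewrite cardsT card_ord big_pred0 ?mul1e// => i; rewrite inE.
rewrite /cond_prob DE /=.
have -> : [set w | X1 w <= x] `&` [set w | order_stat X r w <= t] =
    [set w | `]-oo, x]%classic (X (Ordinal hn) w) /\
             (r <= #|hits X `]-oo, t] w|)%N].
  by apply/seteqP; split=> w /=; rewrite order_stat_leE// in_itv.
rewrite (prob_joint (p := F t))// -SE tailr.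
case: ifPn => [xt|]; last rewrite -ltNge => tx.
  rewrite (_ : _ `&` _ = `]-oo, x]%classic); last first.
    apply/seteqP; split=> y /=; rewrite !in_itv/=; first by case.
    by move=> yx; split=> //; exact: le_trans xt.
  rewrite (_ : _ `\` _ = set0); last first.
    apply/seteqP; split=> y //=; rewrite !in_itv/= => -[yx]; apply.
    exact: le_trans xt.
  by rewrite preimage_set0 measure0 mul0e adde0 PX.
rewrite (_ : _ `&` _ = `]-oo, t]%classic); last first.
  apply/seteqP; split=> y /=; rewrite !in_itv/=; first by case.
  by move=> yt; split=> //; exact: le_trans (ltW tx).
have -> : P (X (Ordinal hn) @^-1` (`]-oo, x] `\` `]-oo, t])) = (F x - F t)%:E.
  have mX y : measurable (X1 @^-1` `]-oo, y]) by exact: measurable_funPTI.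
  transitivity (P (X1 @^-1` `]-oo, x] `\` X1 @^-1` `]-oo, t])); first by [].
  have tx' : X1 @^-1` `]-oo, t] `<=` X1 @^-1` `]-oo, x].
    by apply: preimage_subset; apply: subset_itvl; rewrite bnd_simp ltW.
  rewrite measureD//; last by rewrite (le_lt_trans (probability_le1 _ _)) ?ltry.
  by rewrite setIidr// EFinB; congr (_ - _)%E; exact: PX.
rewrite PX /=; congr (_ / _); ring.
Qed.
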